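(* Let $(\mathcal{C},\mathbb{E},\mathfrak{s})$ be an extriangulated category. Suppose that $$E\xrightarrow{\mu}I\xrightarrow{\pi}F\overset{\delta}{\dashrightarrow}\qquad\text{and}\qquad E\xrightarrow{\mu'}I'\xrightarrow{\pi'}F'\overset{\delta'}{\dashrightarrow}$$ are two $\mathbb{E}$-triangles in which $I$ and $I'$ are injective. Then $I\oplus F'\cong I'\oplus F$.
   Context: Extriangulated categories (Nakaoka–Palu). Let $\mathcal{C}$ be an additive category and $\mathbb{E}\colon\mathcal{C}^{\mathrm{op}}\times\mathcal{C}\to\mathrm{Ab}$ an additive bifunctor. An element $\delta\in\mathbb{E}(C,A)$ is an $\mathbb{E}$-extension; for $a\colon A\to A'$ and $c\colon C'\to C$ write $a_*\delta=\mathbb{E}(C,a)(\delta)$ and $c^*\delta=\mathbb{E}(c,A)(\delta)$. A morphism of extensions $(a,c)\colon\delta\to\delta'$, with $\delta\in\mathbb{E}(C,A)$, $\delta'\in\mathbb{E}(C',A')$, is a pair $a\colon A\to A'$, $c\colon C\to C'$ with $a_*\delta=c^*\delta'$. The extension $\delta\oplus\delta'\in\mathbb{E}(C\oplus C',A\oplus A')$ is the one with components $(\delta,0,0,\delta')$. Sequences $A\xrightarrow{x}B\xrightarrow{y}C$ and $A\xrightarrow{x'}B'\xrightarrow{y'}C$ are equivalent if there is an isomorphism $b\colon B\to B'$ with $bx=x'$, $y'b=y$; $[A\xrightarrow{x}B\xrightarrow{y}C]$ denotes the equivalence class. A realization $\mathfrak{s}$ assigns to each $\delta\in\mathbb{E}(C,A)$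 a class $\mathfrak{s}(\delta)=[A\to B\to C]$ such that for every morphism $(a,c)\colon\delta\to\delta'$ with $\mathfrak{s}(\delta)=[A\xrightarrow{x}B\xrightarrow{y}C]$, $\mathfrak{s}(\delta')=[A'\xrightarrow{x'}B'\xrightarrow{y'}C']$ there is $b\colon B\to B'$ with $bx=x'a$, $y'b=cy$. It is additive if $\mathfrak{s}(0)=[A\to A\oplus C\to C]$ (canonical maps) for $0\in\mathbb{E}(C,A)$ and $\mathfrak{s}(\delta\oplus\delta')=\mathfrak{s}(\delta)\oplus\mathfrak{s}(\delta')$. The triple $(\mathcal{C},\mathbb{E},\mathfrak{s})$ is an extriangulated category if $\mathfrak{s}$ is an additive realization and the following hold. (ET3) If $\delta,\delta'$ are realized by $A\xrightarrow{x}B\xrightarrow{y}C$ and $A'\xrightarrow{x'}B'\xrightarrow{y'}C'$ and $a,b$ satisfy $bx=x'a$, there is $c\colon C\to C'$ with $cy=y'b$ and $a_*\delta=c^*\delta'$. (ET3)$^{\mathrm{op}}$ Dually, if $b,c$ satisfy $y'b=cy$, there is $a\colon A\to A'$ with $x'a=bx$ and $a_*\delta=c^*\delta'$. (ET4) If $\delta\in\mathbb{E}(D,A)$, $\delta'\in\mathbb{E}(F,B)$ are realized by $A\xrightarrow{f}B\xrightarrow{f'}D$ and $B\xrightarrow{g}C\xrightarrow{g'}F$, there are an object $E$, morphisms $d\colon D\to E$, $e\colon E\to F$, $h'\colon C\to E$ and $\delta''\in\mathbb{E}(E,A)$ realized by $A\xrightarrow{h}C\xrightarrow{h'}E$ with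 $h=gf$, $h'g=df'$, $eh'=g'$, such that $D\xrightarrow{d}E\xrightarrow{e}F$ realizes $f'_*\delta'$, $d^*\delta''=\delta$, and $f_*\delta''=e^*\delta'$. (ET4)$^{\mathrm{op}}$ If $\delta\in\mathbb{E}(B,D)$, $\delta'\in\mathbb{E}(C,F)$ are realized by $D\xrightarrow{f'}A\xrightarrow{f}B$ and $F\xrightarrow{g'}B\xrightarrow{g}C$, there are an object $E$, morphisms $d\colon D\to E$, $e\colon E\to F$, $h'\colon E\to A$ and $\delta''\in\mathbb{E}(C,E)$ realized by $E\xrightarrow{h'}A\xrightarrow{h}C$ with $h=gf$, $h'd=f'$, $fh'=g'e$, such that $D\xrightarrow{d}E\xrightarrow{e}F$ realizes $g'^*\delta$, $e_*\delta''=\delta'$, and $d_*\delta=g^*\delta''$. If $A\xrightarrow{x}B\xrightarrow{y}C$ realizes $\delta\in\mathbb{E}(C,A)$, it is called a conflation, $x$ an inflation ($\rightarrowtail$), $y$ a deflation ($\twoheadrightarrow$), and the pair, written $A\xrightarrow{x}B\xrightarrow{y}C\overset{\delta}{\dashrightarrow}$, an $\mathbb{E}$-triangle. An object $I$ is injective if for every $\mathbb{E}$-triangle $A\xrightarrow{x}B\xrightarrow{y}C\dashrightarrow$ and every $f\colon A\to I$ there is $g\colon B\to I$ with $gx=f$. *)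

(* Defs.v *)
From HB Require Import structures.
From mathcomp Require Import all_boot all_order all_algebra.

Set Implicit Arguments.
Unset Strict Implicit.
Unset Printing Implicit Defensive.

Import GRing.Theory.
Local Open Scope ring_scope.

(* The zero object and the binary biproducts are carried as chosen data; they
   are determined up to unique isomorphism by the equations below. *)
Record additiveCategory := AdditiveCategory {
  Ob :> Type;
  Mor : Ob -> Ob -> zmodType;
  idm : forall A, Mor A A;
  mcomp : forall A B C, Mor B C -> Mor A B -> Mor A C;
  mcompA : forall A B C D (h : Mor C D) (g : Mor B C) (f : Mor A B),
    mcomp h (mcomp g f) = mcomp (mcomp h g) f;
  mcomp1m : forall A B (f : Mor A B), mcomp (idm B) f = f;
  mcompm1 : forall A B (f : Mor A B), mcomp f (idm A) = f;
  mcompDl : forall A B C (g g' : Mor B C) (f : Mor A B),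
    mcomp (g + g') f = mcomp g f + mcomp g' f;
  mcompDr : forall A B C (g : Mor B C) (f f' : Mor A B),
    mcomp g (f + f') = mcomp g f + mcomp g f';
  zeroOb : Ob;
  to_zeroOb : forall A (f : Mor A zeroOb), f = 0;
  from_zeroOb : forall A (f : Mor zeroOb A), f = 0;
  biprod : Ob -> Ob -> Ob;
  in1 : forall A B, Mor A (biprod A B);
  in2 : forall A B, Mor B (biprod A B);
  pr1 : forall A B, Mor (biprod A B) A;
  pr2 : forall A B, Mor (biprod A B) B;
  pr1_in1 : forall A B, mcomp (pr1 A B) (in1 A B) = idm A;
  pr2_in2 : forall A B, mcomp (pr2 A B) (in2 A B) = idm B;
  pr1_in2 : forall A B, mcomp (pr1 A B) (in2 A B) = 0;
  pr2_in1 : forall A B, mcomp (pr2 A B) (in1 A B) = 0;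
  biprod_id : forall A B,
    mcomp (in1 A B) (pr1 A B) + mcomp (in2 A B) (pr2 A B) = idm (biprod A B)
}.

Arguments Mor {a} A B.
Arguments idm {a} A.
Arguments mcomp {a A B C} g f.
Arguments zeroOb {a}.
Arguments biprod {a} A B.
Arguments in1 {a} A B.
Arguments in2 {a} A B.
Arguments pr1 {a} A B.
Arguments pr2 {a} A B.

Declare Scope cat_scope.
Delimit Scope cat_scope with cat.
Notation "g ∘ f" := (mcomp g f) (at level 40, left associativity) : cat_scope.
Notation "A ⊕ B" := (biprod A B) (at level 50, left associativity) : cat_scope.
Local Open Scope cat_scope.

Definition is_iso (C : additiveCategory) (A B : C) (f : Mor A B) : Prop :=
  exists g : Mor B A, g ∘ f = idm A /\ f ∘ g = idm B.

Definition isomorphic (C : additiveCategory) (A B : C) : Prop :=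
  exists f : Mor A B, is_iso f.

Definition hom_sum (C : additiveCategory) (A A' B B' : C)
    (f : Mor A B) (f' : Mor A' B') : Mor (A ⊕ A') (B ⊕ B') :=
  in1 B B' ∘ f ∘ pr1 A A' + in2 B B' ∘ f' ∘ pr2 A A'.

(* [Ext E C A] is E(C, A): contravariant in the first argument, covariant in
   the second; [push a] is a_* and [pull c] is c^*. *)
Record extBifunctor (C : additiveCategory) := ExtBifunctor {
  Ext :> C -> C -> zmodType;
  push : forall X A A', Mor A A' -> Ext X A -> Ext X A';
  pull : forall X X' A, Mor X' X -> Ext X A -> Ext X' A;
  push1 : forall X A (d : Ext X A), push (idm A) d = d;
  push_comp : forall X A A' A'' (a' : Mor A' A'') (a : Mor A A') (d : Ext X A),
    push (a' ∘ a) d = push a' (push a d);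
  pull1 : forall X A (d : Ext X A), pull (idm X) d = d;
  pull_comp : forall X X' X'' A (c : Mor X' X) (c' : Mor X'' X') (d : Ext X A),
    pull (c ∘ c') d = pull c' (pull c d);
  push_pull : forall X X' A A' (a : Mor A A') (c : Mor X' X) (d : Ext X A),
    push a (pull c d) = pull c (push a d);
  pushD : forall X A A' (a : Mor A A') (d d' : Ext X A),
    push a (d + d') = push a d + push a d';
  pullD : forall X X' A (c : Mor X' X) (d d' : Ext X A),
    pull c (d + d') = pull c d + pull c d';
  push_addm : forall X A A' (a a' : Mor A A') (d : Ext X A),
    push (a + a') d = push a d + push a' d;
  pull_addm : forall X X' A (c c' : Mor X' X) (d : Ext X A),
    pull (c + c') d = pull c d + pull c' d
}.

Arguments Ext {C} e X A.
Arguments push {C e X A A'} a d.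
Arguments pull {C e X X' A} c d.

Definition ext_morphism (C : additiveCategory) (E : extBifunctor C)
    (X A X' A' : C) (d : E X A) (d' : E X' A')
    (a : Mor A A') (c : Mor X X') : Prop :=
  push a d = pull c d'.

(* The formula is justified by [ext_sumP]: this is the unique extension with
   components (d, 0, 0, d'). *)
Definition ext_sum (C : additiveCategory) (E : extBifunctor C)
    (X A X' A' : C) (d : E X A) (d' : E X' A') : E (X ⊕ X') (A ⊕ A') :=
  push (in1 A A') (pull (pr1 X X') d) + push (in2 A A') (pull (pr2 X X') d').

Section ExtSum.
Variables (C : additiveCategory) (E : extBifunctor C).

Lemma push0 (X A A' : C) (a : Mor A A') : push a (0 : E X A) = 0.
Proof. by apply: (addrI (push a 0)); rewrite -pushD !addr0. Qed.

Lemma pull0 (X X' A : C) (c : Mor X' X) : pull c (0 : E X A) = 0.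
Proof. by apply: (addrI (pull c 0)); rewrite -pullD !addr0. Qed.

Lemma push_zerom (X A A' : C) (d : E X A) : push (0 : Mor A A') d = 0.
Proof. by apply: (addrI (push 0 d)); rewrite -push_addm !addr0. Qed.

Lemma pull_zerom (X X' A : C) (d : E X A) : pull (0 : Mor X' X) d = 0.
Proof. by apply: (addrI (pull 0 d)); rewrite -pull_addm !addr0. Qed.

Lemma ext_sumP (X A X' A' : C) (d : E X A) (d' : E X' A')
    (e : E (X ⊕ X') (A ⊕ A')) :
  e = ext_sum d d' <->
  [/\ push (pr1 A A') (pull (in1 X X') e) = d,
      push (pr2 A A') (pull (in1 X X') e) = 0,
      push (pr1 A A') (pull (in2 X X') e) = 0
    & push (pr2 A A') (pull (in2 X X') e) = d'].
Proof.
split=> [->|[e11 e21 e12 e22]].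
  by split; rewrite /ext_sum pullD pushD -!push_pull -!push_comp -!pull_comp;
    rewrite !(pr1_in1, pr2_in2, pr1_in2, pr2_in1);
    rewrite !(push1, pull1, push_zerom, pull_zerom, push0, addr0, add0r).
have eE : e = pull (pr1 X X') (pull (in1 X X') e) +
              pull (pr2 X X') (pull (in2 X X') e).
  by rewrite -!pull_comp -pull_addm biprod_id pull1.
have fE Y (f : E Y (A ⊕ A')) : f = push (in1 A A') (push (pr1 A A') f) +
                                   push (in2 A A') (push (pr2 A A') f).
  by rewrite -!push_comp -push_addm biprod_id push1.
rewrite {1}eE (fE _ (pull (in1 X X') e)) (fE _ (pull (in2 X X') e)).
by rewrite e11 e21 e12 e22 !push0 addr0 add0r -!push_pull.
Qed.

End ExtSum.

Record sequence (C : additiveCategory) (A X : C) := Sequence {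
  mid : C;
  lmap : Mor A mid;
  rmap : Mor mid X
}.

Arguments Sequence {C A X mid} lmap rmap.

Definition seq_equiv (C : additiveCategory) (A X : C)
    (S S' : sequence A X) : Prop :=
  exists b : Mor (mid S) (mid S'),
    [/\ is_iso b, b ∘ lmap S = lmap S' & rmap S' ∘ b = rmap S].

Definition seq_sum (C : additiveCategory) (A X A' X' : C)
    (S : sequence A X) (S' : sequence A' X') : sequence (A ⊕ A') (X ⊕ X') :=
  Sequence (hom_sum (lmap S) (lmap S')) (hom_sum (rmap S) (rmap S')).

(* An equivalence class of sequences is a predicate [c] of the form
   [seq_equiv S]; thus [c T] is the same as c = [T]. *)
Definition seq_class (C : additiveCategory) (A X : C)
    (c : sequence A X -> Prop) : Prop :=
  exists S, forall T, c T <-> seq_equiv S T.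

Record realization (C : additiveCategory) (E : extBifunctor C) := Realization {
  real_class : forall X A : C, E X A -> sequence A X -> Prop;
  real_classP : forall (X A : C) (d : E X A), seq_class (real_class d);
  real_lift : forall (X A X' A' : C) (d : E X A) (d' : E X' A')
      (a : Mor A A') (c : Mor X X') (S : sequence A X) (S' : sequence A' X'),
    ext_morphism d d' a c -> real_class d S -> real_class d' S' ->
    exists b : Mor (mid S) (mid S'),
      b ∘ lmap S = lmap S' ∘ a /\ rmap S' ∘ b = c ∘ rmap S
}.

Arguments real_class {C E} r {X A} d S.

Section Extriangulated.
Variables (C : additiveCategory) (E : extBifunctor C) (s : realization E).

(* The pair of A -x-> B -y-> X and d is an E-triangle. *)
Definition triangle (A B X : C) (x : Mor A B) (y : Mor B X) (d : E X A) : Prop :=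
  real_class s d (Sequence x y).

Definition additive_realization : Prop :=
  (forall A X : C, triangle (in1 A X) (pr2 A X) 0) /\
  (forall (A X A' X' : C) (d : E X A) (d' : E X' A')
      (S : sequence A X) (S' : sequence A' X'),
    real_class s d S -> real_class s d' S' ->
    real_class s (ext_sum d d') (seq_sum S S')).

Definition ET3 : Prop :=
  forall (A B X A' B' X' : C)
    (x : Mor A B) (y : Mor B X) (d : E X A)
    (x' : Mor A' B') (y' : Mor B' X') (d' : E X' A')
    (a : Mor A A') (b : Mor B B'),
  triangle x y d -> triangle x' y' d' -> b ∘ x = x' ∘ a ->
  exists c : Mor X X', c ∘ y = y' ∘ b /\ ext_morphism d d' a c.

Definition ET3op : Prop :=
  forall (A B X A' B' X' : C)
    (x : Mor A B) (y : Mor B X) (d : E X A)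
    (x' : Mor A' B') (y' : Mor B' X') (d' : E X' A')
    (b : Mor B B') (c : Mor X X'),
  triangle x y d -> triangle x' y' d' -> y' ∘ b = c ∘ y ->
  exists a : Mor A A', x' ∘ a = b ∘ x /\ ext_morphism d d' a c.

Definition ET4 : Prop :=
  forall (A B D G F : C)
    (f : Mor A B) (f' : Mor B D) (d : E D A)
    (g : Mor B G) (g' : Mor G F) (d' : E F B),
  triangle f f' d -> triangle g g' d' ->
  exists (Z : C) (u : Mor D Z) (v : Mor Z F) (h' : Mor G Z) (d'' : E Z A),
    [/\ triangle (g ∘ f) h' d'', h' ∘ g = u ∘ f' & v ∘ h' = g'] /\
    [/\ triangle u v (push f' d'), pull u d'' = d & push f d'' = pull v d'].

Definition ET4op : Prop :=
  forall (D A B F G : C)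
    (f' : Mor D A) (f : Mor A B) (d : E B D)
    (g' : Mor F B) (g : Mor B G) (d' : E G F),
  triangle f' f d -> triangle g' g d' ->
  exists (Z : C) (u : Mor D Z) (v : Mor Z F) (h' : Mor Z A) (d'' : E G Z),
    [/\ triangle h' (g ∘ f) d'', h' ∘ u = f' & f ∘ h' = g' ∘ v] /\
    [/\ triangle u v (pull g' d), push v d'' = d' & push u d = pull g d''].

Record extriangulated : Prop := Extriangulated {
  ext_additive : additive_realization;
  ext_ET3 : ET3;
  ext_ET3op : ET3op;
  ext_ET4 : ET4;
  ext_ET4op : ET4op
}.

Definition injective_object (I : C) : Prop :=
  forall (A B X : C) (x : Mor A B) (y : Mor B X) (d : E X A),
  triangle x y d -> forall f : Mor A I, exists g : Mor B I, g ∘ x = f.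

End Extriangulated.

(* Main.v *)
Require Import Defs.
From mathcomp Require Import all_boot all_order all_algebra.

(** Choose [f] extending [mu'] along [mu] and [g] extending [mu] along [mu'].
    They give an isomorphism I ⊕ I' -> I' ⊕ I carrying (0, mu') to (0, mu).
    Adding the split conflations 0 -> I -> I and 0 -> I' -> I' to the given
    triangles therefore yields conflations with isomorphic inflations and
    with cokernels I ⊕ F' and I' ⊕ F.  These cokernels are isomorphic: the maps
    supplied by (ET3) compose to [1 - h] with [h y = 0] and [h^* d = 0]; the
    latter makes [h] factor through [y], so [h h = 0]. *)

Import GRing.Theory.
Local Open Scope ring_scope.
Local Open Scope cat_scope.

Section Additive.
Context {C : additiveCategory}.

Lemma mcomp0m (X Y Z : C) (f : Mor X Y) : (0 : Mor Y Z) ∘ f = 0.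
Proof. by apply: (addrI (0 ∘ f)); rewrite -mcompDl !addr0. Qed.

Lemma mcompm0 (X Y Z : C) (g : Mor Y Z) : g ∘ (0 : Mor X Y) = 0.
Proof. by apply: (addrI (g ∘ 0)); rewrite -mcompDr !addr0. Qed.

Lemma mcompNl (X Y Z : C) (g : Mor Y Z) (f : Mor X Y) : (- g) ∘ f = - (g ∘ f).
Proof. by apply/eqP; rewrite -addr_eq0 -mcompDl addNr mcomp0m. Qed.

Lemma mcompNr (X Y Z : C) (g : Mor Y Z) (f : Mor X Y) : g ∘ (- f) = - (g ∘ f).
Proof. by apply/eqP; rewrite -addr_eq0 -mcompDr addNr mcompm0. Qed.

Lemma mcompBl (X Y Z : C) (g g' : Mor Y Z) (f : Mor X Y) :
  (g - g') ∘ f = g ∘ f - g' ∘ f.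
Proof. by rewrite mcompDl mcompNl. Qed.

Lemma mcompBr (X Y Z : C) (g : Mor Y Z) (f f' : Mor X Y) :
  g ∘ (f - f') = g ∘ f - g ∘ f'.
Proof. by rewrite mcompDr mcompNr. Qed.

Lemma in2_pr2_zero (X : C) : in2 zeroOb X ∘ pr2 zeroOb X = idm (zeroOb ⊕ X).
Proof.
by rewrite -[RHS]biprod_id (to_zeroOb (pr1 zeroOb X)) mcompm0 add0r.
Qed.

Lemma is_iso_of_inverses {X Y : C} (f : Mor X Y) (g g' : Mor Y X) :
  g ∘ f = idm X -> f ∘ g' = idm Y -> is_iso f.
Proof.
move=> gf fg'; have gg' : g = g'.
  by rewrite -[g]mcompm1 -fg' mcompA gf mcomp1m.
by exists g; split; rewrite // gg'.
Qed.

Definition pairm {W X Y : C} (u : Mor W X) (v : Mor W Y) : Mor W (X ⊕ Y) :=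
  in1 X Y ∘ u + in2 X Y ∘ v.

Lemma pr1_pairm {W X Y : C} (u : Mor W X) (v : Mor W Y) :
  pr1 X Y ∘ pairm u v = u.
Proof. by rewrite mcompDr !mcompA pr1_in1 pr1_in2 mcomp0m addr0 mcomp1m. Qed.

Lemma pr2_pairm {W X Y : C} (u : Mor W X) (v : Mor W Y) :
  pr2 X Y ∘ pairm u v = v.
Proof. by rewrite mcompDr !mcompA pr2_in1 pr2_in2 mcomp0m add0r mcomp1m. Qed.

Lemma pairm_comp {V W X Y : C} (u : Mor W X) (v : Mor W Y) (w : Mor V W) :
  pairm u v ∘ w = pairm (u ∘ w) (v ∘ w).
Proof. by rewrite /pairm mcompDl !mcompA. Qed.

(* In coordinates (x, y) ↦ (y - f q, q) with q = x + g y. *)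
Definition shear {X Y : C} (f : Mor X Y) (g : Mor Y X) :
    Mor ((zeroOb ⊕ X) ⊕ Y) ((zeroOb ⊕ Y) ⊕ X) :=
  let q := pr2 zeroOb X ∘ pr1 _ Y + g ∘ pr2 _ Y in
  pairm (in2 zeroOb Y ∘ (pr2 _ Y - f ∘ q)) q.

Lemma shear_pairm {W X Y : C} (f : Mor X Y) (g : Mor Y X)
    (u : Mor W X) (v : Mor W Y) :
  shear f g ∘ pairm (in2 zeroOb X ∘ u) v =
  pairm (in2 zeroOb Y ∘ (v - f ∘ (u + g ∘ v))) (u + g ∘ v).
Proof.
rewrite /shear pairm_comp -mcompA mcompBl -(mcompA f) mcompDl -!mcompA.
by rewrite pr1_pairm pr2_pairm [pr2 _ _ ∘ _]mcompA pr2_in2 mcomp1m.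
Qed.

(** Applied to (y - f q, q), the second shear has as its own q the sum (y - f q) + f q = y, and its
    first coordinate is q - g y = x. *)
Lemma shearK {X Y : C} (f : Mor X Y) (g : Mor Y X) :
  shear g f ∘ shear f g = idm _.
Proof.
rewrite {2}/shear shear_pairm subrK addrK mcompA in2_pr2_zero mcomp1m.
by rewrite /pairm biprod_id.
Qed.

Lemma shear_iso {X Y : C} (f : Mor X Y) (g : Mor Y X) : is_iso (shear f g).
Proof. by exists (shear g f); rewrite !shearK. Qed.

End Additive.

Section Triangles.
Context {C : additiveCategory} {E : extBifunctor C} {s : realization E}.

(** Since [h] pulls [d] back to 0, the pair (1, [h]) is a morphism from the split extension to [d].
    It lifts to a map A ⊕ W -> B, whose restriction to W is the required factor. *)
Lemma triangle_factor (Cext : extriangulated s) {A B X W : C}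
    {x : Mor A B} {y : Mor B X} {d : E X A} (h : Mor W X) :
  triangle s x y d -> pull h d = 0 -> exists k : Mor W B, h = y ∘ k.
Proof.
move=> tri hd; have [tri0 _] := ext_additive Cext.
have [|b [_ /= yb]] := real_lift (a := idm A) (c := h) _ (tri0 A W) tri.
  by rewrite /ext_morphism push1 hd.
by exists (b ∘ in2 A W); rewrite mcompA yb -mcompA pr2_in2 mcompm1.
Qed.

Lemma triangle_endo_invertible (Cext : extriangulated s) {A B X : C}
    {x : Mor A B} {y : Mor B X} {d : E X A} (c : Mor X X) :
  triangle s x y d -> c ∘ y = y -> pull c d = d ->
  exists c', c' ∘ c = idm X /\ c ∘ c' = idm X.
Proof.
move=> tri cy cd; pose h := idm X - c.
have hd : pull h d = 0.
  by apply: (addIr (pull c d)); rewrite -pull_addm subrK pull1 add0r cd.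
have [k hk] := triangle_factor Cext h tri hd.
have hh : h ∘ h = 0 by rewrite {2}hk mcompA mcompBl mcomp1m cy subrr mcomp0m.
have -> : c = idm X - h by rewrite /h opprB addrC subrK.
(* As [h] squares to zero, the geometric series for the inverse of 1 - [h] stops at 1 + [h]. *)
exists (idm X + h); split.
  by rewrite mcompBr mcompm1 mcompDl mcomp1m hh addr0 addrK.
by rewrite mcompBl mcomp1m mcompDr mcompm1 hh addr0 addrK.
Qed.

Lemma cone_isomorphic (Cext : extriangulated s) {A B X B' X' : C}
    {x : Mor A B} {y : Mor B X} {d : E X A}
    {x' : Mor A B'} {y' : Mor B' X'} {d' : E X' A} {b : Mor B B'} :
  triangle s x y d -> triangle s x' y' d' -> is_iso b -> b ∘ x = x' ->
  isomorphic X X'.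
Proof.
move=> tri tri' [b' [b'b bb']] bx.
have b'x' : b' ∘ x' = x by rewrite -bx mcompA b'b mcomp1m.
have [|c [cy cd]] := ext_ET3 Cext (a := idm A) (b := b) tri tri'.
  by rewrite mcompm1.
have [|c' [cy' cd']] := ext_ET3 Cext (a := idm A) (b := b') tri' tri.
  by rewrite mcompm1.
rewrite /ext_morphism !push1 in cd cd'.
have [||u [uc _]] := triangle_endo_invertible Cext (c' ∘ c) tri.
- by rewrite -mcompA cy mcompA cy' -mcompA b'b mcompm1.
- by rewrite pull_comp -cd' -cd.
have [||v [_ cv]] := triangle_endo_invertible Cext (c ∘ c') tri'.
- by rewrite -mcompA cy' mcompA cy -mcompA bb' mcompm1.
- by rewrite pull_comp -cd -cd'.
(* (ET3) does not make [c] and [c'] mutually inverse. Only their composites are known to be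
   invertible, which gives [c] a left and a right inverse. *)
exists c; apply: (is_iso_of_inverses _ (u ∘ c') (c' ∘ v)).
  by rewrite -mcompA.
by rewrite mcompA.
Qed.

(** The split conflation on [zeroOb] and Y has middle term [zeroOb ⊕ Y], hence the extra zero
    summand here and in [shear]. The zero component of the inflation is written [in2 zeroOb Y ∘ 0]
    so that [shear_pairm] applies to it. *)
Lemma triangle_add_split (Cext : extriangulated s) {A B X : C} (Y : C)
    {x : Mor A B} {y : Mor B X} {d : E X A} :
  triangle s x y d ->
  triangle s (pairm (in2 zeroOb Y ∘ 0) (x ∘ pr2 zeroOb A))
    (hom_sum (pr2 zeroOb Y) y) (ext_sum 0 d).
Proof.
move=> tri; have [tri0 triD] := ext_additive Cext.
have := triD _ _ _ _ _ _ _ _ (tri0 zeroOb Y) tri.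
rewrite /seq_sum /hom_sum /= (from_zeroOb (in1 zeroOb Y)).
by rewrite /pairm !mcompm0 mcomp0m -mcompA.
Qed.

End Triangles.

Theorem proposition3p3 (C : additiveCategory) (E : extBifunctor C)
    (s : realization E) (Cext : extriangulated s)
    (A I F I' F' : C)
    (mu : Mor A I) (pi : Mor I F) (d : Ext E F A)
    (mu' : Mor A I') (pi' : Mor I' F') (d' : Ext E F' A)
    (tri : triangle s mu pi d) (tri' : triangle s mu' pi' d')
    (injI : injective_object s I) (injI' : injective_object s I') :
  isomorphic (I ⊕ F') (I' ⊕ F).
Proof.
have [f fmu] := injI' _ _ _ _ _ _ tri mu'; have [g gmu] := injI _ _ _ _ _ _ tri' mu.
have tri1 := triangle_add_split Cext I tri'.
have tri2 := triangle_add_split Cext I' tri.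
apply: (cone_isomorphic Cext tri1 tri2 (shear_iso f g)).
(* On (0, [mu']) the shear has q = [g ∘ mu'] = [mu], so its first coordinate [mu'] - [f ∘ mu]
   vanishes. *)
by rewrite shear_pairm add0r (mcompA g) gmu (mcompA f) fmu subrr.
Qed.
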